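(* Let $n\ge1$, let $a\ge1$ be an odd integer and $r\ge 0$. Starting from the identity, perform $r$ independent type B $a$-shuffles. Then the probability that the resulting element of $B_n$ has sign $\mathrm{sgn}_B=1$ equals \[ \frac12+\frac{1}{2a^{rn}}. \]
   Context: $B_n$ is the group of bijections $w$ of $\{-n,\dots,n\}$ with $w(-i)=-w(i)$, $w(0)=0$; $\mathrm{des}_B(w)=|\{0\le i\le n-1:w(i)>w(i+1)\}|$. Writing $w=u^J$ ($u\in S_n$, $J\subseteq[n]$ the set of positions $j$ with $w(j)=-u(j)$), $\mathrm{sgn}_B(w)=(-1)^{|J|}\mathrm{sgn}(u)$. A type B $a$-shuffle ($a$ odd) of $n$ cards: choose $(j_1,\dots,j_a)$ with $j_i\ge0$, $\sum j_i=n$ with probability $\binom{n}{j_1,\dots,j_a}/a^n$; cut the deck into packets of sizes $j_1,\dots,j_a$ from the top; turn the even-numbered packets face up; then drop cards one at a time, choosing packet $i$ with probability $A_i/(A_1+\cdots+A_a)$ where $A_i$ is the current size of packet $i$. The resulting arrangement (order and orientation of cards) is an element $w\in B_n$, and started from the identity it is obtained with probability $P^B_{n,a}(w)=\binom{n+(a-1)/2-\mathrm{des}_B(w^{-1})}{n}/a^n$. Iterated shuffles are performed independently, composing the resulting signed permutations. *)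

(* Defs.v *)
From mathcomp Require Import all_boot all_order all_algebra all_fingroup.

Set Implicit Arguments.
Unset Strict Implicit.
Unset Printing Implicit Defensive.

Import GRing.Theory Num.Theory.
Local Open Scope ring_scope.

(* {-n, ..., n}: the ordinal k stands for the integer k - n. *)
Notation pm n := ('I_(n.*2.+1)).

Definition pm0 (n : nat) : pm n := inord n.
Definition pmopp (n : nat) (i : pm n) : pm n := rev_ord i.
(* The positive integer j + 1, for j : 'I_n. *)
Definition pmpos (n : nat) (j : 'I_n) : pm n := inord (n + j.+1).

Definition B (n : nat) : {set {perm pm n}} :=
  [set w : {perm pm n} |
    (w (pm0 n) == pm0 n) && [forall i, w (pmopp i) == pmopp (w i)]].

(* w = u^J *)
Definition is_signed_perm (n : nat) (w : {perm pm n})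
    (u : 'S_n) (J : {set 'I_n}) : bool :=
  [forall j, w (pmpos j) ==
     if j \in J then pmopp (pmpos (u j)) else pmpos (u j)].

(* The default 0 is never reached on B n, by B_signed_perm below. *)
Definition sgnB (n : nat) (w : {perm pm n}) : int :=
  if [pick p : 'S_n * {set 'I_n} | is_signed_perm w p.1 p.2] is Some p
  then (-1) ^+ #|p.2| * (-1) ^+ (odd_perm p.1) else 0.

(* The cards are 1, ..., n; a card lying face up is recorded as the opposite
   of its label. The arrangement w has card w(i) in the i-th position from the
   top. *)
Definition deck (n : nat) (w : {perm pm n}) : seq (pm n) :=
  [seq w (pmpos i) | i <- enum 'I_n].

(* Turning a packet over reverses the order of its cards as well as their
   orientations. *)
Definition turn_over (n : nat) (p : seq (pm n)) : seq (pm n) :=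
  map (@pmopp n) (rev p).

(* Packets are indexed from 0, so the even-numbered ones have odd index. *)
Definition cut_and_turn (n a : nat) (j : a.-tuple 'I_n.+1) (d : seq (pm n)) :
    seq (seq (pm n)) :=
  let ps := reshape (map val j) d in
  [seq (let p := nth [::] ps i in if odd i then turn_over p else p)
     | i <- iota 0 a].

(* Probability that dropping m cards from the packets ps onto pile results in
   the deck d. A card is dropped from the bottom (the end) of its packet onto
   the top (the head) of the pile. *)
Fixpoint drop_prob (T : eqType) (m : nat) (ps : seq (seq T))
    (pile d : seq T) : rat :=
  if m is m'.+1 then
    \sum_(i < size ps)
      let p := nth [::] ps i in
      let k := (size p).-1 in
      (size p)%:R / (sumn (shape ps))%:R *
      drop_prob m' (set_nth [::] ps i (take k p)) (drop k p ++ pile) d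
  else (pile == d)%:R.

(* P^B_{n,a}(w) *)
Definition shuffle_prob (n a : nat) (w : {perm pm n}) : rat :=
  \sum_(j : a.-tuple 'I_n.+1 | (\sum_(i < a) tnth j i == n)%N)
    (n`!)%:R / (\prod_(i < a) (tnth j i)`!)%N%:R / a%:R ^+ n *
    drop_prob n (cut_and_turn j (deck 1%g)) [::] (deck w).

(* If the deck is in arrangement v and a shuffle produces s, the new
   arrangement is v \o s, that is s * v for the
   multiplication of {perm _}; it is w exactly when s = w * v^-1. *)
Fixpoint iter_shuffle_prob (n a r : nat) (w : {perm pm n}) : rat :=
  if r is r'.+1 then
    \sum_(v in B n) iter_shuffle_prob a r' v * shuffle_prob a (w * v^-1)%g
  else (w == 1%g)%:R.

Lemma val_pmpos (n : nat) (j : 'I_n) : pmpos j = (n + j.+1)%N :> nat.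
Proof.
by rewrite /pmpos inordK // ltnS -addnn leq_add2l ltn_ord.
Qed.

Lemma val_pmopp (n : nat) (i : pm n) : pmopp i = (n.*2 - i)%N :> nat.
Proof. by rewrite /= subSS. Qed.

Lemma pmpos_inj (n : nat) : injective (@pmpos n).
Proof.
move=> i j /(congr1 (@nat_of_ord _))/eqP; rewrite !val_pmpos.
by rewrite eqn_add2l eqSS => /eqP/val_inj.
Qed.

Lemma pmoppK (n : nat) : involutive (@pmopp n).
Proof. exact: rev_ordK. Qed.

Lemma pmpos_neq_opp (n : nat) (i j : 'I_n) : pmpos i <> pmopp (pmpos j).
Proof.
move/(congr1 (@nat_of_ord _))/eqP; rewrite val_pmopp !val_pmpos.
rewrite -addnn subnDl; apply/negP; rewrite neq_ltn orbC; apply/orP; left.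
by apply: leq_ltn_trans (leq_subr _ _) _; rewrite addnS ltnS leq_addr.
Qed.

Lemma pm_cases (n : nat) (x : pm n) : x <> pm0 n ->
  exists k : 'I_n, x = pmpos k \/ x = pmopp (pmpos k).
Proof.
move=> x0; have xle : (x <= n.*2)%N by rewrite -ltnS.
have := ltngtP x n; case=> [ltx|gtx|eqx]; last first.
- by case: x0; apply/val_inj; rewrite /= inordK // ltnS -addnn leq_addr.
- have kP : ((x - n).-1 < n)%N.
    by rewrite prednK ?subn_gt0 // leq_subLR addnn.
  exists (Ordinal kP); left; apply: ord_inj; rewrite val_pmpos /=.
  by rewrite prednK ?subn_gt0 // subnKC // ltnW.
- have kP : ((n - x).-1 < n)%N by rewrite prednK ?subn_gt0 // leq_subr.
  exists (Ordinal kP); right; apply: ord_inj.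
  rewrite val_pmopp val_pmpos /= prednK ?subn_gt0 //.
  by rewrite subnDA (_ : n.*2 - n = n)%N ?subKn ?(ltnW ltx) // -addnn addnK.
Qed.

Lemma pmsign_inj (n : nat) (b c : bool) (i j : 'I_n) :
  (if b then pmopp (pmpos i) else pmpos i)
    = (if c then pmopp (pmpos j) else pmpos j) -> b = c /\ i = j.
Proof.
case: b c => [] [].
- by move=> /(can_inj (@pmoppK n))/pmpos_inj.
- by move=> /esym/pmpos_neq_opp.
- by move=> /pmpos_neq_opp.
- by move=> /pmpos_inj.
Qed.

Lemma B_signed_perm (n : nat) (w : {perm pm n}) : w \in B n ->
  exists! p : 'S_n * {set 'I_n}, is_signed_perm w p.1 p.2.
Proof.
rewrite inE => /andP[/eqP w0 /forallP wopp].
have opp_w i : w (pmopp i) = pmopp (w i) by apply/eqP.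
have posN0 (j : 'I_n) : pmpos j <> pm0 n.
  move/(congr1 (@nat_of_ord _)); rewrite val_pmpos inordK.
    by move/eqP; rewrite -[X in _ == X]addn0 eqn_add2l.
  by rewrite ltnS -addnn leq_addr.
have /fin_all_exists[f fP] : forall j : 'I_n,
    exists k, w (pmpos j) = pmpos k \/ w (pmpos j) = pmopp (pmpos k).
  by move=> j; apply: pm_cases; rewrite -w0 => /perm_inj/posN0.
have f_inj : injective f.
  move=> i j eqf.
  suff: w (pmpos i) = w (pmpos j) \/ w (pmpos i) = w (pmopp (pmpos j)).
    by case=> /perm_inj; [move/pmpos_inj | move/pmpos_neq_opp].
  rewrite opp_w; case: (fP i) => ->; case: (fP j) => ->; rewrite eqf ?pmoppK;
    by [left | right].
pose J := [set j | w (pmpos j) == pmopp (pmpos (f j))].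
have wE j : w (pmpos j) =
    if j \in J then pmopp (pmpos (f j)) else pmpos (f j).
  by rewrite inE; case: eqP => // ?; case: (fP j).
exists (perm f_inj, J); split=> [|[u K] /= /forallP uKP].
  by apply/forallP => j /=; rewrite permE wE.
have eqs j : (j \in J) = (j \in K) /\ f j = u j.
  by apply: pmsign_inj; rewrite -wE; apply/eqP.
congr pair; first by apply/permP => j; rewrite permE; case: (eqs j).
by apply/setP => j; case: (eqs j).
Qed.

(* Main.v *)
(* A shuffle is a uniformly random word of [n] letters among the [a] packets,
   which tells from which packet each card is dropped. Exchanging two distinct
   letters in positions [2k] and [2k+1] reverses the sign of the result, so the
   mean sign only sees the words made of repeated pairs (and a last letter if
   [n] is odd). There a letter naming a face-up packet contributes a factor -1
   per pair, and summing each pair over the packets gives 1 - 1 + ... + 1 = 1: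
   the mean sign is [1 / a ^ n]. As the sign is multiplicative, it becomes
   [1 / a ^ (r * n)] after [r] shuffles, whence the probability of sign 1. *)
Require Import Defs.
From mathcomp Require Import all_boot all_order all_algebra all_fingroup.

Import GRing.Theory Num.Theory.
Local Open Scope ring_scope.

(** * The group structure of [B n] and its sign character *)

Lemma pmpos_neq0 n (j : 'I_n) : pmpos j != pm0 n.
Proof.
rewrite -val_eqE /= val_pmpos inordK ?ltnS -?addnn ?leq_addr //.
by rewrite -[X in _ != X]addn0 eqn_add2l.
Qed.

Lemma pmopp0 n : pmopp (pm0 n) = pm0 n.
Proof.
have vn : pm0 n = n :> nat by rewrite inordK // ltnS -addnn leq_addr.
by apply: ord_inj; rewrite val_pmopp vn -addnn addnK.
Qed.

Lemma pmoppos_neq0 n (j : 'I_n) : pmopp (pmpos j) != pm0 n.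
Proof. by rewrite -pmopp0 (can_eq (@pmoppK n)) pmpos_neq0. Qed.

Lemma BP n (w : {perm pm n}) :
  reflect (w (pm0 n) = pm0 n /\ forall i, w (pmopp i) = pmopp (w i)) (w \in B n).
Proof.
rewrite inE; apply: (iffP andP) => -[/eqP w0 wN]; split=> //.
  by move=> i; apply/eqP; move/forallP: wN.
by apply/forallP => i; rewrite wN.
Qed.

Lemma B_group_set n : group_set (B n).
Proof.
apply/group_setP; split=> [|v w /BP[v0 vN] /BP[w0 wN]]; apply/BP.
  by split=> [|i]; rewrite !perm1.
by split=> [|i]; rewrite !permM ?v0 ?w0 ?vN ?wN.
Qed.

Canonical B_group n := Group (B_group_set n).

Lemma sgnB_signed n (w : {perm pm n}) u J : w \in B n -> is_signed_perm w u J ->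
  sgnB w = (-1) ^+ #|J| * (-1) ^+ odd_perm u.
Proof.
move=> wB wuJ; have [q [_ q_uniq]] := B_signed_perm wB.
rewrite /sgnB; case: pickP => [p /q_uniq <-|/(_ (u, J))]; last by rewrite wuJ.
by rewrite (q_uniq (u, J)).
Qed.

Lemma signr_card (T : finType) (J : {set T}) :
  (-1) ^+ #|J| = \prod_j (-1) ^+ (j \in J) :> int.
Proof.
rewrite -prodr_const [LHS]big_mkcond; apply: eq_bigr => j _.
by case: (j \in J).
Qed.

Lemma sgnB_mul n (v w : {perm pm n}) : v \in B n -> w \in B n ->
  sgnB (v * w)%g = sgnB v * sgnB w.
Proof.
move=> vB wB; have [[u J] [/= vuJ _]] := B_signed_perm vB.
have [[t K] [/= wtK _]] := B_signed_perm wB.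
(* The product applies [v] first, so position [j] changes sign once for [j] in [J] and once more for
   [u j] in [K]. *)
have vw : is_signed_perm (v * w)%g (u * t)%g [set j | (j \in J) (+) (u j \in K)].
  have [_ wN] := BP _ _ wB.
  apply/forallP => j; rewrite inE !permM.
  rewrite (eqP (forallP vuJ j)); have /eqP wj := forallP wtK (u j).
  by case: (j \in J) => /=; rewrite ?wN wj; case: (u j \in K); rewrite ?pmoppK.
rewrite (sgnB_signed _ _ _ _ (groupM vB wB) vw) (sgnB_signed _ _ _ _ vB vuJ).
rewrite (sgnB_signed _ _ _ _ wB wtK) odd_permM signr_addb mulrACA; congr (_ * _).
(* As products over positions, the signs of the sets multiply under symmetric difference; reindexing
   by [u] recovers the factor of [K]. *)
rewrite !signr_card [X in _ * X](reindex_inj (@perm_inj _ u)) -big_split /=.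
by apply: eq_bigr => j _; rewrite inE signr_addb.
Qed.

Lemma sgnB_pm1 n (w : {perm pm n}) : w \in B n -> sgnB w = 1 \/ sgnB w = -1.
Proof.
move=> wB; have [[u J] [/= wuJ _]] := B_signed_perm wB.
rewrite (sgnB_signed _ _ _ _ wB wuJ) -signr_odd.
by case: (odd _); case: (odd_perm u); rewrite ?mulr1 ?mul1r ?mulrNN; [left|right|right|left].
Qed.

Lemma is_signed_perm1 n : is_signed_perm (1 : {perm pm n})%g 1%g set0.
Proof. by apply/forallP => j; rewrite inE !perm1. Qed.

Lemma sgnB1 n : sgnB (1 : {perm pm n})%g = 1.
Proof.
by rewrite (sgnB_signed _ _ _ _ (group1 _) (is_signed_perm1 n)) cards0 odd_perm1.
Qed.

(** * Arrangements, and how their sign reacts to exchanging and turning cards *)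

Lemma size_deck n (w : {perm pm n}) : size (deck w) = n.
Proof. by rewrite size_map size_enum_ord. Qed.

Lemma nth_deck n (w : {perm pm n}) x (i : 'I_n) : nth x (deck w) i = w (pmpos i).
Proof. by rewrite (nth_map i) ?nth_ord_enum ?size_enum_ord. Qed.

(** Fixing [pm0] and commuting with [pmopp], an element of [B n] is determined by its values on the
    positive integers. *)
Lemma deck_inj n : {in B n &, injective (@deck n)}.
Proof.
move=> v w /BP[v0 vN] /BP[w0 wN] eq_d; apply/permP => x.
have eq_pos k : v (pmpos k) = w (pmpos k).
  by rewrite -!(nth_deck _ _ (pm0 n)) eq_d.
have [->|/eqP/pm_cases[k [->|->]]] := eqVneq x (pm0 n); first by rewrite v0.
  exact: eq_pos.
by rewrite vN wN eq_pos.
Qed.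

(** Precomposition with this element turns over the card in position [i] only. *)
Definition neg_at n (i : 'I_n) : {perm pm n} := tperm (pmpos i) (pmopp (pmpos i)).

Lemma neg_at_pos n (i k : 'I_n) :
  neg_at n i (pmpos k) = if k == i then pmopp (pmpos k) else pmpos k.
Proof.
rewrite /neg_at; have [->|ne] := eqVneq; first by rewrite tpermL.
rewrite tpermD //; first by rewrite (inj_eq (@pmpos_inj n)) eq_sym.
by apply/eqP => /esym/pmpos_neq_opp.
Qed.

Lemma neg_at_B n (i : 'I_n) : neg_at n i \in B n.
Proof.
apply/BP; split=> [|x]; first by rewrite tpermD ?pmpos_neq0 ?pmoppos_neq0.
by rewrite /neg_at (inj_tperm _ _ _ (inv_inj (@pmoppK n))) pmoppK tpermC.
Qed.

Lemma neg_at_sgn n (i : 'I_n) : sgnB (neg_at n i) = -1.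
Proof.
rewrite (sgnB_signed _ _ 1%g [set i] (neg_at_B n i)) ?cards1 ?odd_perm1 ?mulr1 //.
by apply/forallP => k; rewrite neg_at_pos perm1 inE.
Qed.

(** The opposites are exchanged too, so that the result commutes with [pmopp]. Precomposition
    exchanges the cards in positions [i] and [j]. *)
Definition swap_at n (i j : 'I_n) : {perm pm n} :=
  (tperm (pmpos i) (pmpos j) * tperm (pmopp (pmpos i)) (pmopp (pmpos j)))%g.

Lemma swap_at_pos n (i j k : 'I_n) :
  swap_at n i j (pmpos k) = pmpos (tperm i j k).
Proof.
have tE := inj_tperm i j k (@pmpos_inj n).
by rewrite permM -tE (tpermD (z := pmpos _)) //; apply/eqP => /esym/pmpos_neq_opp.
Qed.

Lemma swap_at_opp n (i j k : 'I_n) :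
  swap_at n i j (pmopp (pmpos k)) = pmopp (pmpos (tperm i j k)).
Proof.
have tE := inj_tperm i j k (@pmpos_inj n).
have tN := inj_tperm (pmpos i) (pmpos j) (pmpos k) (inv_inj (@pmoppK n)).
by rewrite permM (tpermD (z := pmopp _)) -?tN -?tE //; apply/eqP => /pmpos_neq_opp.
Qed.

Lemma swap_at_B n (i j : 'I_n) : swap_at n i j \in B n.
Proof.
have s0 : swap_at n i j (pm0 n) = pm0 n.
  by rewrite permM !tpermD ?pmpos_neq0 ?pmoppos_neq0.
apply/BP; split=> // x; have [->|/eqP/pm_cases[k [->|->]]] := eqVneq x (pm0 n).
- by rewrite pmopp0 s0 pmopp0.
- by rewrite swap_at_opp swap_at_pos.
- by rewrite pmoppK swap_at_opp swap_at_pos pmoppK.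
Qed.

Lemma swap_at_sgn n (i j : 'I_n) : i != j -> sgnB (swap_at n i j) = -1.
Proof.
move=> ij; rewrite (sgnB_signed _ _ (tperm i j) set0 (swap_at_B n i j)).
  by rewrite cards0 odd_tperm ij mul1r.
by apply/forallP => k; rewrite inE swap_at_pos.
Qed.

(* [deck] is injective on [B n], so this is the [e]-th power of the sign of the
   arrangement [d], extended by [0] to the sequences that are not arrangements.
   The case [e = 0] serves to compute total probabilities. *)
Definition deck_sgn e n (d : seq (pm n)) : rat :=
  \sum_(w in B n) (sgnB w)%:~R ^+ e * (deck w == d)%:R.

(** Reindex by left multiplication by [s] and use multiplicativity of the sign. Since [s * w]
    applies [s] first, [s] acts on positions: a rearrangement of positions costs the sign of [s]. *)
Lemma deck_sgn_mul e n (s : {perm pm n}) (d d' : seq (pm n)) : s \in B n ->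
  (forall w, w \in B n -> (deck (s * w)%g == d) = (deck w == d')) ->
  deck_sgn e n d = (sgnB s)%:~R ^+ e * deck_sgn e n d'.
Proof.
move=> sB dd'; rewrite /deck_sgn (reindex_inj (mulgI s)) mulr_sumr.
apply: eq_big => [w|w]; first by rewrite groupMl.
rewrite groupMl // => wB.
by rewrite sgnB_mul // intrM exprMn dd' // mulrA.
Qed.

Lemma deckP n (w : {perm pm n}) (d : seq (pm n)) : size d = n ->
  reflect (forall i : 'I_n, w (pmpos i) = nth (pm0 n) d i) (deck w == d).
Proof.
move=> sd; apply: (iffP eqP) => [<- i|wd]; first by rewrite nth_deck.
apply: (@eq_from_nth _ (pm0 n)); first by rewrite size_deck.
by move=> i; rewrite size_deck => ltin; rewrite -(wd (Ordinal ltin)) -(nth_deck _ _ (pm0 n)).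
Qed.

Lemma deck_sgn_size e n (d : seq (pm n)) : size d != n -> deck_sgn e n d = 0.
Proof.
move=> sd; rewrite /deck_sgn big1 // => w _; case: eqP; rewrite ?mulr0 //.
by move=> wd; rewrite -wd size_deck eqxx in sd.
Qed.

Lemma deck_sgn_swap e n (d1 d2 : seq (pm n)) x y :
  deck_sgn e n (d1 ++ x :: y :: d2) = (-1) ^+ e * deck_sgn e n (d1 ++ y :: x :: d2).
Proof.
(* A sequence of the wrong length is no arrangement, and both sides vanish. *)
have [sd|sd] := eqVneq (size (d1 ++ x :: y :: d2)) n; last first.
  rewrite !deck_sgn_size ?mulr0 //; move: sd; rewrite !size_cat //.
have sd' : size (d1 ++ y :: x :: d2) = n by move: sd; rewrite !size_cat.
have lt1 : ((size d1).+1 < n)%N.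
  by apply: leq_trans (eq_leq sd); rewrite size_cat /= !addnS !ltnS leq_addr.
pose i := Ordinal (ltnW lt1); pose j := Ordinal lt1.
have ij : i != j by rewrite -val_eqE /= ltn_eqF.
rewrite (deck_sgn_mul e n (swap_at n i j) _ (d1 ++ y :: x :: d2) (swap_at_B n i j)).
  by rewrite swap_at_sgn.
have nth_swap (k : 'I_n) : nth (pm0 n) (d1 ++ x :: y :: d2) (tperm i j k)
    = nth (pm0 n) (d1 ++ y :: x :: d2) k.
  case: tpermP => [->|->|/eqP ki /eqP kj]; rewrite !nth_cat /=.
  - by rewrite ltnn ltnNge leqnSn subSnn subnn.
  - by rewrite ltnn ltnNge leqnSn subSnn subnn.
  have [//|le_k] := ltnP k (size d1).
  rewrite -val_eqE /= in ki; rewrite -val_eqE /= in kj.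
  have -> : (k - size d1 = (k - size d1 - 2).+2)%N.
    move: le_k; rewrite leq_eqVlt eq_sym (negPf ki) /= leq_eqVlt eq_sym (negPf kj) /=.
    by move=> lt_k; rewrite -[RHS]addn2 subnK // leq_subRL ?addn2 // ltnW // ltnW.
  by [].
move=> w wB; apply/deckP/deckP => // eq_w k.
  by rewrite -nth_swap -eq_w permM swap_at_pos tpermK.
by rewrite permM swap_at_pos eq_w -nth_swap tpermK.
Qed.

Lemma deck_sgn_opp e n (d1 d2 : seq (pm n)) x :
  deck_sgn e n (d1 ++ pmopp x :: d2) = (-1) ^+ e * deck_sgn e n (d1 ++ x :: d2).
Proof.
have [sd|sd] := eqVneq (size (d1 ++ pmopp x :: d2)) n; last first.
  rewrite !deck_sgn_size ?mulr0 //; move: sd; rewrite !size_cat //.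
have sd' : size (d1 ++ x :: d2) = n by move: sd; rewrite !size_cat.
have lt1 : (size d1 < n)%N by apply: leq_trans (eq_leq sd); rewrite size_cat /= addnS ltnS leq_addr.
pose i := Ordinal lt1.
rewrite (deck_sgn_mul e n (neg_at n i) _ (d1 ++ x :: d2) (neg_at_B n i)).
  by rewrite neg_at_sgn.
have nth_opp (k : 'I_n) : nth (pm0 n) (d1 ++ pmopp x :: d2) k =
    if k == i then pmopp (nth (pm0 n) (d1 ++ x :: d2) k)
    else nth (pm0 n) (d1 ++ x :: d2) k.
  rewrite -val_eqE !nth_cat /=; have [->|ne] := eqVneq; first by rewrite ltnn subnn.
  have [//|le_k] := ltnP k (size d1).
  by rewrite -(@prednK (k - size d1)) // subn_gt0 ltn_neqAle eq_sym ne.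
move=> w /BP[_ wN]; have eq_s k : (neg_at n i * w)%g (pmpos k) =
    if k == i then pmopp (w (pmpos k)) else w (pmpos k).
  by rewrite permM neg_at_pos; case: eqP => // _; rewrite wN.
apply/deckP/deckP => // eq_w k; move: (eq_w k); rewrite eq_s nth_opp; last by move->.
by case: eqP => // _; apply: (inv_inj (@pmoppK n)).
Qed.

Lemma deck_sgn_deck e n (w : {perm pm n}) : w \in B n ->
  deck_sgn e n (deck w) = (sgnB w)%:~R ^+ e.
Proof.
move=> wB; rewrite /deck_sgn (bigD1 w) //= eqxx mulr1 big1 ?addr0 // => v /andP[vB vw].
case: eqP => [/(deck_inj n v w vB wB) evw|_]; last by rewrite mulr0.
by rewrite evw eqxx in vw.
Qed.

(** The card [x] passes the cards of [d2] one by one, by adjacent exchanges. *)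
Lemma deck_sgn_move e n (d1 d2 d3 : seq (pm n)) x :
  deck_sgn e n (d1 ++ x :: d2 ++ d3)
    = (-1) ^+ (e * size d2) * deck_sgn e n (d1 ++ d2 ++ x :: d3).
Proof.
elim: d2 d1 => [|y d2 IH] d1; first by rewrite muln0 mul1r.
rewrite /= deck_sgn_swap -cat_rcons IH cat_rcons mulrA -exprD mulnS.
by [].
Qed.

(** Reversing k cards takes k(k-1)/2 exchanges and reorienting them k sign changes; the total
    k(k+1)/2 has the parity of [uphalf k]. *)
Lemma deck_sgn_turn_over e n (d1 d2 p : seq (pm n)) :
  deck_sgn e n (d1 ++ turn_over p ++ d2)
    = (-1) ^+ (e * uphalf (size p)) * deck_sgn e n (d1 ++ p ++ d2).
Proof.
elim: p d1 d2 => [|x p IH] d1 d2; first by rewrite muln0 mul1r.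
rewrite /turn_over rev_cons map_rcons cat_rcons catA deck_sgn_opp -catA.
have := deck_sgn_move e n d1 (turn_over p) d2 x.
rewrite -(cat_rcons x d1) IH cat_rcons size_map size_rev.
set T := deck_sgn _ _ (d1 ++ turn_over p ++ _) => /(congr1 ( *%R ((-1) ^+ (e * size p)))).
rewrite mulrA signrMK -/T => <-; rewrite !mulrA -!exprD.
congr (_ * _).
(* With k the size of [p], this is the congruence of [uphalf k.+1] and [1 + k + uphalf k] modulo
   2. *)
rewrite -[LHS]signr_odd -[RHS]signr_odd -mulnS -mulnDr !oddM oddD /= uphalf_half.
by rewrite oddD oddb addNb addbA -addNb; case: (odd (size p)); case: (odd (_./2)).
Qed.

(** * Sums over all words of [m] letters below [a] *)

Fixpoint wsum (a m : nat) (F : seq nat -> rat) : rat :=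
  if m is m'.+1 then \sum_(i < a) wsum a m' (fun f => F (val i :: f)) else F [::].

Lemma eq_wsum a m F G :
  (forall f, size f = m -> all (ltn^~ a) f -> F f = G f) -> wsum a m F = wsum a m G.
Proof.
elim: m F G => [|m IH] F G FG /=; first exact: FG.
by apply: eq_bigr => i _; apply: IH => f sf af; apply: FG; rewrite /= ?sf // ltn_ord.
Qed.

Lemma wsumZ a m c F : wsum a m (fun f => c * F f) = c * wsum a m F.
Proof.
elim: m F => [|m IH] F //=; rewrite mulr_sumr; apply: eq_bigr => i _.
exact: (IH (fun f => F (val i :: f))).
Qed.

Lemma wsum_sum (I : finType) (P : pred I) a m F :
  wsum a m (fun f => \sum_(x | P x) F x f) = \sum_(x | P x) wsum a m (F x).
Proof.
elim: m F => [|m IH] F //=; rewrite exchange_big; apply: eq_bigr => i _.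
exact: (IH (fun x f => F x (val i :: f))).
Qed.

Lemma wsum0 a m F : (forall f, F f = 0) -> wsum a m F = 0.
Proof. by elim: m F => [|m IH] F F0 //=; rewrite big1 // => i _; apply: IH. Qed.

Lemma wsum1 a m : wsum a m (fun=> 1) = a%:R ^+ m.
Proof.
elim: m => [|m IH] //=; rewrite (eq_bigr (fun=> a%:R ^+ m)) // sumr_const card_ord.
by rewrite -[LHS]mulr_natl exprS.
Qed.

(** * Dropping cards in the order prescribed by a word *)

Section Packets.
Context {T : eqType}.
Implicit Types (ps : seq (seq T)) (pile d : seq T) (f : seq nat).

Definition rest i ps :=
  let p := nth [::] ps i in set_nth [::] ps i (take (size p).-1 p).

(** A sequence rather than a card: it is empty when the packet is, so no default card is
    required. *)
Definition bottom i ps := let p := nth [::] ps i in drop (size p).-1 p.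

Fixpoint run f ps pile :=
  if f is i :: f' then run f' (rest i ps) (bottom i ps ++ pile) else pile.

(** The condition for [f] to record a complete drop that empties every packet. Letters from [a] on
    are unconstrained here and are excluded separately. *)
Definition fits a f ps := [forall i : 'I_a, count_mem (val i) f == size (nth [::] ps i)].

Lemma size_rest i ps : (i < size ps)%N -> size (rest i ps) = size ps.
Proof. by move=> lti; rewrite size_set_nth; apply/maxn_idPr. Qed.

Lemma size_nth_rest i k ps :
  size (nth [::] (rest i ps) k) = (size (nth [::] ps k) - (k == i))%N.
Proof.
rewrite /rest nth_set_nth /=; case: eqP => [->|_]; last by rewrite subn0.
by rewrite size_take_min subn1; apply/minn_idPl; rewrite leq_pred.
Qed.

(** A drop from an empty packet leaves it unchanged, hence the nonemptiness condition next to the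
    one on the remaining packets. *)
Lemma fits_cons a i f ps : (i < a)%N ->
  fits a (i :: f) ps = (0 < size (nth [::] ps i))%N && fits a f (rest i ps).
Proof.
move=> lti; apply/forallP/andP => [fP|[p0 /forallP fP] k].
  have p0 : (0 < size (nth [::] ps i))%N.
    by have /eqP <- := fP (Ordinal lti); rewrite /= eqxx.
  split=> //; apply/forallP => k; have /= := fP k; rewrite size_nth_rest.
  by rewrite [i == k]eq_sym => /eqP <-; rewrite addKn.
have /eqP /= -> := fP k; rewrite size_nth_rest [i == k]eq_sym subnKC //.
by case: eqP => // ->.
Qed.

Lemma run_cat f ps pile : run f ps pile = run f ps [::] ++ pile.
Proof.
elim: f ps pile => [|i f IH] ps pile //=.
by rewrite IH [in RHS]IH cats0 catA.
Qed.

Lemma nth_rest i k ps : i != k -> nth [::] (rest k ps) i = nth [::] ps i.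
Proof. by move=> ik; rewrite nth_set_nth /= (negPf ik). Qed.

Lemma restC i k ps : i != k -> rest i (rest k ps) = rest k (rest i ps).
Proof.
move=> ik; have ki : k != i by rewrite eq_sym.
rewrite {1}/rest nth_rest // [in RHS]/rest -/(rest i ps) nth_rest //.
by rewrite /rest set_set_nth (negPf ki).
Qed.

Lemma bottom_rest i k ps : i != k -> bottom i (rest k ps) = bottom i ps.
Proof. by move=> ik; rewrite /bottom nth_rest. Qed.

Lemma flatten_nth i ps : (i < size ps)%N ->
  flatten ps = flatten (take i ps) ++ nth [::] ps i ++ flatten (drop i.+1 ps).
Proof.
by move=> lti; rewrite -{1}(cat_take_drop i ps) flatten_cat (drop_nth [::]).
Qed.

Lemma restE i ps : (i < size ps)%N -> rest i ps = take i ps ++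
  take (size (nth [::] ps i)).-1 (nth [::] ps i) :: drop i.+1 ps.
Proof. by move=> lti; rewrite /rest set_nthE lti. Qed.

Lemma fits_nil ps : fits (size ps) [::] ps -> flatten ps = [::].
Proof.
move=> /forallP ps0; apply: size0nil; rewrite size_flatten sumnE big_map.
rewrite (big_nth [::]) big_mkord big1 // => i _.
by have /= /eqP <- := ps0 i.
Qed.

(** This handles an unpaired last letter: nothing remains after the drop, so the packets held just
    that one card. *)
Lemma fits_one i ps : (i < size ps)%N -> fits (size ps) [:: i] ps ->
  flatten ps = nth [::] ps i /\ bottom i ps = nth [::] ps i.
Proof.
move=> lti; rewrite fits_cons // => /andP[_ fr].
have sr : size (nth [::] (rest i ps) i) = 0.
  by have /eqP <- := forallP fr (Ordinal lti).
have := fr; rewrite -{1}(size_rest _ _ lti) => /fits_nil/(congr1 size).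
rewrite restE // flatten_cat /= !size_cat => /eqP; rewrite !addn_eq0.
move=> /and3P[/nilP t0 _ /nilP d0]; rewrite (flatten_nth _ _ lti) t0 d0 cats0.
rewrite size_nth_rest eqxx subn1 in sr.
by rewrite /bottom sr drop0.
Qed.

Lemma sumn_shape ps : sumn (shape ps) = (\sum_(i < size ps) size (nth [::] ps i))%N.
Proof. by rewrite sumnE big_map (big_nth [::]) big_mkord. Qed.

Lemma sumn_rest i ps : (i < size ps)%N -> (0 < size (nth [::] ps i))%N ->
  sumn (shape ps) = (sumn (shape (rest i ps))).+1.
Proof.
move=> lti p0; rewrite !sumn_shape size_rest //.
rewrite (bigD1 (Ordinal lti)) //= [in RHS](bigD1 (Ordinal lti)) //=.
rewrite size_nth_rest eqxx -addSn -[in LHS](@subnK 1 _ p0) addn1; congr (_ + _)%N.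
by apply: eq_bigr => k; rewrite -val_eqE size_nth_rest /= => /negPf->; rewrite subn0.
Qed.

Lemma prod_fact_rest i ps : (i < size ps)%N -> (0 < size (nth [::] ps i))%N ->
  (\prod_(k < size ps) (size (nth [::] ps k))`! = size (nth [::] ps i) *
    \prod_(k < size ps) (size (nth [::] (rest i ps) k))`!)%N.
Proof.
move=> lti p0.
rewrite (bigD1 (Ordinal lti)) //= [in RHS](bigD1 (Ordinal lti)) //=.
rewrite size_nth_rest eqxx mulnA subn1 -[in LHS](prednK p0) factS prednK //.
congr (_ * _)%N.
by apply: eq_bigr => k; rewrite -val_eqE size_nth_rest /= => /negPf->; rewrite subn0.
Qed.

(* Every interleaving of the packets is equally likely. *)
Lemma drop_prob_words m ps pile d : sumn (shape ps) = m ->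
  (m`!)%:R / (\prod_(i < size ps) (size (nth [::] ps i))`!)%N%:R * drop_prob m ps pile d
  = wsum (size ps) m (fun f => (fits (size ps) f ps)%:R * (run f ps pile == d)%:R).
Proof.
elim: m ps pile => [|m IH] ps pile sps /=.
  have s0 : forall i : 'I_(size ps), size (nth [::] ps i) = 0%N.
    move=> i; apply/eqP; rewrite -leqn0 -[X in (_ <= X)%N]sps sumn_shape.
    by rewrite (bigD1 i) //= leq_addr.
  rewrite big1 => [|i _]; last by rewrite s0.
  rewrite divr1 mul1r (_ : fits _ _ _) ?mul1r //.
  by apply/forallP => i; rewrite s0.
rewrite mulr_sumr; apply: eq_bigr => i _.
(* An empty packet is chosen with probability 0, and no word starting with its index fits. *)
have [p0|] := posnP (size (nth [::] ps i)).
  rewrite p0 !mul0r mulr0 wsum0 // => f.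
  by rewrite fits_cons ?ltn_ord // p0 mul0r.
move=> p0; have lti := ltn_ord i.
have IHi := IH (rest i ps) (bottom i ps ++ pile).
rewrite size_rest // in IHi.
rewrite (eq_wsum _ _ _ (fun f => (fits (size ps) f (rest i ps))%:R *
  (run f (rest i ps) (bottom i ps ++ pile) == d)%:R)); last first.
  by move=> f _ _; rewrite fits_cons // p0.
rewrite -IHi; last by apply/succn_inj; rewrite -sumn_rest.
(* Dropping a card divides the product of factorials by the size of its packet, which cancels the
   numerator of the drop probability; [m.+1] cancels its denominator. *)
rewrite mulrA; congr (_ * _); rewrite (prod_fact_rest _ _ lti p0) sps.
set P := (\prod_(_ < _) _)%N; set s := size _.
rewrite factS !natrM mulf_div [m.+1%:R * _]mulrC [s%:R * P%:R]mulrC.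
rewrite -(mulrA m`!%:R) -(mulrA P%:R) (mulrC s%:R) -mulf_div divff ?mulr1 //.
by rewrite mulf_neq0 // pnatr_eq0 -lt0n.
Qed.

End Packets.

(** * The sign of the pile obtained from a word *)

Lemma deck_sgn_rest e n i (ps : seq (seq (pm n))) pile :
  (i < size ps)%N -> (0 < size (nth [::] ps i))%N ->
  deck_sgn e n (flatten ps ++ pile)
    = (-1) ^+ (e * size (flatten (drop i.+1 ps)))
      * deck_sgn e n (flatten (rest i ps) ++ bottom i ps ++ pile).
Proof.
move=> lti; rewrite (flatten_nth _ _ lti) restE // /bottom flatten_cat /=.
case/lastP: (nth [::] ps i) => // q x _.
rewrite size_rcons -cats1 take_size_cat // drop_size_cat //.
(* The bottom card [x] passes every card of the later packets. *)
by rewrite -!catA (catA _ q) (catA _ q) deck_sgn_move.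
Qed.

Lemma size_bottom (T : eqType) i (ps : seq (seq T)) : (0 < size (nth [::] ps i))%N ->
  size (bottom i ps) = 1%N.
Proof. by move=> p0; rewrite size_drop -subn1 subKn. Qed.

(** The default case leaves the unpaired last letter of a word of odd length free. *)
Fixpoint doubled (f : seq nat) : bool :=
  if f is i :: k :: f' then (i == k) && doubled f' else true.

Lemma deck_sgn_run0 n f (ps : seq (seq (pm n))) pile :
  all (ltn^~ (size ps)) f -> fits (size ps) f ps ->
  deck_sgn 0 n (run f ps pile) = deck_sgn 0 n (flatten ps ++ pile).
Proof.
elim: f ps pile => [|i f IH] ps pile /=; first by move=> _ /fits_nil ->.
case/andP => lti allf; rewrite fits_cons // => /andP[p0 fitsf].
by rewrite IH ?size_rest // -(mul1r (deck_sgn 0 n _)) (deck_sgn_rest 0 n i ps).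
Qed.

(** Exchanging the indices shows that the off-diagonal part is its own opposite, hence zero. *)
Lemma sum_antisym (I : finType) (H : I -> I -> rat) :
  (forall i k, i != k -> H i k = - H k i) -> \sum_i \sum_k H i k = \sum_i H i i.
Proof.
move=> HN; pose S := \sum_i \sum_(k | k != i) H i k.
have SN : S = - S.
  rewrite {1}/S (exchange_big_dep predT) //= -sumrN; apply: eq_bigr => k _.
  rewrite -sumrN; apply: eq_big => [i|i ki]; first by rewrite eq_sym.
  by rewrite HN // eq_sym.
have S0 : S = 0 by apply/eqP; rewrite -eqNr -SN.
transitivity (\sum_i H i i + S); last by rewrite S0 addr0.
rewrite -big_split; apply: eq_bigr => i _ /=.
by rewrite (bigD1 i).
Qed.

(* Exchanging the first two letters of a word with distinct ones exchanges two
   cards of the final arrangement, so only doubled words survive; those move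
   pairs of cards, which does not affect the sign. *)
Lemma wsum_run n m (ps : seq (seq (pm n))) pile :
  wsum (size ps) m (fun f => (fits (size ps) f ps)%:R * deck_sgn 1 n (run f ps pile))
  = wsum (size ps) m (fun f => (doubled f)%:R *
      ((fits (size ps) f ps)%:R * deck_sgn 1 n (flatten ps ++ pile))).
Proof.
have [k] := ubnP m; elim: k m ps pile => // k IH [|[|m]] ps pile lt_k.
- rewrite /= mul1r; case: (boolP (fits _ _ _)) => [/fits_nil->|_] //.
  by rewrite !mul0r.
- apply: eq_bigr => i _ /=; rewrite mul1r.
  case: (boolP (fits _ _ _)) => [|_]; last by rewrite !mul0r.
  by move=> /(fits_one _ _ (ltn_ord i))[-> ->].
pose H (i j : 'I_(size ps)) := wsum (size ps) m (fun f =>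
  (fits (size ps) [:: val i, val j & f] ps)%:R
    * deck_sgn 1 n (run [:: val i, val j & f] ps pile)).
(* Drops from distinct packets commute up to exchanging the two adjacent cards they put on the
   pile. *)
have HN i j : i != j -> H i j = - H j i.
  rewrite -val_eqE /= => ij; have ji : val j != i by rewrite eq_sym.
  rewrite -mulN1r -wsumZ; apply: eq_wsum => f _ _.
  rewrite mulrCA; have -> : fits (size ps) [:: val j, val i & f] ps =
    fits (size ps) [:: val i, val j & f] ps.
    by apply: eq_forallb => l; rewrite /= addnCA.
  have [|_] := boolP (fits _ _ _); last by rewrite !mul0r.
  have lti := ltn_ord i; have ltj := ltn_ord j.
  rewrite !fits_cons // => /and3P[pi pj _]; rewrite !mul1r.
  rewrite size_nth_rest (negPf ji) subn0 in pj.
  rewrite /= !(bottom_rest _ _ ps) // (restC i j) //.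
  move: (size_bottom _ _ _ pi) (size_bottom _ _ _ pj).
  case: (bottom i ps) => [|x []] // _; case: (bottom j ps) => [|y []] // _ /=.
  by rewrite run_cat [in RHS]run_cat deck_sgn_swap expr1.
have HD i : H i i = wsum (size ps) m (fun f => (doubled f)%:R *
    ((fits (size ps) [:: val i, val i & f] ps)%:R * deck_sgn 1 n (flatten ps ++ pile))).
  have lti := ltn_ord i.
  have fitsE f : fits (size ps) [:: val i, val i & f] ps =
    [&& (0 < size (nth [::] ps i))%N, (0 < size (nth [::] (rest i ps) i))%N &
       fits (size ps) f (rest i (rest i ps))] by rewrite !fits_cons.
  rewrite /H; have [p0|p0] := boolP (0 < size (nth [::] ps i))%N; last first.
    by rewrite !wsum0 // => f; rewrite fitsE (negPf p0) ?mul0r ?mulr0.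
  have [q0|q0] := boolP (0 < size (nth [::] (rest i ps) i))%N; last first.
    by rewrite !wsum0 // => f; rewrite fitsE (negPf q0) andbF ?mul0r ?mulr0.
  pose ps' := rest i (rest i ps).
  pose pile' := bottom i (rest i ps) ++ bottom i ps ++ pile.
  have sps' : size ps' = size ps by rewrite !size_rest.
  have := IH m ps' pile' (ltnW lt_k); rewrite sps' => IHm.
  (* Both cards of a pair pass the same later packets, so the number of exchanges is even. *)
  have -> : deck_sgn 1 n (flatten ps ++ pile) = deck_sgn 1 n (flatten ps' ++ pile').
    rewrite (deck_sgn_rest _ _ i) // (deck_sgn_rest _ _ i (rest i ps)) ?size_rest //.
    rewrite mulrA -exprD.
    have -> : drop i.+1 (rest i ps) = drop i.+1 ps.
      rewrite restE // -cat_rcons drop_size_cat // size_rcons size_take lti //.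
    by rewrite -signr_odd addnn odd_double mul1r.
  rewrite (eq_wsum _ _ _ (fun f => (fits (size ps) f ps')%:R * deck_sgn 1 n (run f ps' pile'))).
    by rewrite IHm; apply: eq_wsum => f _ _; rewrite fitsE p0 q0.
  by move=> f _ _; rewrite fitsE p0 q0.
transitivity (\sum_i \sum_j H i j); first by [].
transitivity (\sum_i H i i).
  exact: sum_antisym.
apply: eq_bigr => i _; rewrite HD /= (bigD1 i) //= eqxx.
rewrite [X in _ + X]big1 ?addr0 // => j; rewrite eq_sym -val_eqE /= => /negPf ij.
by apply: wsum0 => f; rewrite ij mul0r.
Qed.

(** * Cutting the deck, turning packets, and matching cuts with words *)

Lemma deck_sgn_cut e n a (j : a.-tuple 'I_n.+1) (d : seq (pm n)) :
  (\sum_(i < a) tnth j i)%N = n -> size d = n ->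
  deck_sgn e n (flatten (cut_and_turn j d))
    = \prod_(i < a | odd i) (-1) ^+ (e * uphalf (tnth j i)) * deck_sgn e n d.
Proof.
move=> sj sd; rewrite /cut_and_turn; set ps := reshape _ _; set G := fun i => _.
have sumj : sumn (map val j) = n.
  by rewrite sumnE big_map big_tuple.
have sps : size ps = a by rewrite size_reshape size_map size_tuple.
have fps : flatten ps = d by rewrite reshapeKr // sumj sd.
have size_ps i (lti : (i < a)%N) : size (nth [::] ps i) = tnth j (Ordinal lti).
  rewrite -(nth_map [::] 0%N) ?sps // -/(shape ps) reshapeKl ?sumj ?sd //.
  by rewrite (nth_map ord0) ?size_tuple // (tnth_nth ord0).
(* Induction on the number [k] of packets already treated, the others being left as cut. *)
suff main k : (k <= a)%N ->
    deck_sgn e n (flatten (map G (iota 0 k)) ++ flatten (drop k ps))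
    = \prod_(i < k | odd i) (-1) ^+ (e * uphalf (size (nth [::] ps i)))
      * deck_sgn e n (flatten ps).
  have := main a (leqnn a); rewrite drop_oversize ?sps // cats0 fps => ->.
  congr (_ * _); apply: eq_bigr => i _; rewrite size_ps.
  by congr (_ ^+ (_ * uphalf (tnth j _))); apply: val_inj.
elim: k => [|k IH] ltk; first by rewrite big_ord0 mul1r drop0.
have -> : iota 0 k.+1 = iota 0 k ++ [:: k] by rewrite -[in LHS]addn1 iotaD.
rewrite map_cat flatten_cat /= cats0 -catA.
rewrite big_mkcond big_ord_recr -big_mkcond /= mulrAC -IH ?(ltnW ltk) //.
rewrite [in RHS](drop_nth [::]) ?sps //= /G; case: (odd k) => /=; last by rewrite mulr1.
by rewrite deck_sgn_turn_over mulrC.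
Qed.

Lemma size_cut n a (j : a.-tuple 'I_n.+1) (d : seq (pm n)) :
  size (cut_and_turn j d) = a.
Proof. by rewrite size_map size_iota. Qed.

Lemma size_nth_cut n a (j : a.-tuple 'I_n.+1) (d : seq (pm n)) (i : 'I_a) :
  (\sum_(i < a) tnth j i)%N = n -> size d = n ->
  size (nth [::] (cut_and_turn j d) i) = tnth j i.
Proof.
move=> sj sd; rewrite /cut_and_turn (nth_map 0%N) ?size_iota // nth_iota // add0n.
set p := nth _ _ _; transitivity (size p).
  by case: ifP => // _; rewrite size_map size_rev.
have sumj : sumn (map val j) = n by rewrite sumnE big_map big_tuple.
rewrite -(nth_map [::] 0%N) ?size_reshape ?size_map ?size_tuple //.
rewrite -/(shape _) reshapeKl ?sumj ?sd //.
by rewrite (nth_map ord0) ?size_tuple // (tnth_nth ord0).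
Qed.

Lemma sum_count_mem a f : all (ltn^~ a) f -> (\sum_(i < a) count_mem (val i) f)%N = size f.
Proof.
elim: f => [|x f IH] /=; first by rewrite big1.
case/andP=> ltx /IH IHf; rewrite big_split /= IHf -add1n; congr (_ + _)%N.
rewrite (bigD1 (Ordinal ltx)) //= eqxx big1 ?addn0 // => i.
by rewrite -val_eqE /= eq_sym => /negPf ->.
Qed.

(** A word determines its cut, the packet sizes being its letter counts, so a single term
    survives. *)
Lemma sum_fits_cut n a (d : seq (pm n)) f (h : nat -> rat) :
  size d = n -> size f = n -> all (ltn^~ a) f ->
  \sum_(j : a.-tuple 'I_n.+1 | (\sum_(i < a) tnth j i == n)%N)
    (fits a f (cut_and_turn j d))%:R * \prod_(i < a | odd i) h (tnth j i)
  = \prod_(i < a | odd i) h (count_mem (val i) f).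
Proof.
move=> sd sf allf.
pose j0 : a.-tuple 'I_n.+1 := [tuple inord (count_mem (val i) f) | i < a].
have j0E i : tnth j0 i = count_mem (val i) f :> nat.
  by rewrite tnth_mktuple inordK // ltnS -sf count_size.
have sj0 : (\sum_(i < a) tnth j0 i)%N = n.
  by rewrite -[RHS]sf -(sum_count_mem a) //; apply: eq_bigr => i _; rewrite j0E.
rewrite (bigD1 j0) /=; last by apply/eqP.
rewrite (_ : fits _ _ _) ?mul1r; last first.
  by apply/forallP => i; rewrite size_nth_cut // j0E.
rewrite [X in _ + X]big1 ?addr0; first by apply: eq_bigr => i _; rewrite j0E.
move=> j /andP[/eqP sj jj0]; have [/forallP fP|_] := boolP (fits _ _ _); last by rewrite mul0r.
case/eqP: jj0; apply: eq_from_tnth => i; apply: val_inj.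
by rewrite /= j0E; have /eqP -> := fP i; rewrite size_nth_cut.
Qed.

(** * One shuffle: total probability and mean sign *)

Lemma sum_shuffle_prob e n a :
  \sum_(w in B n) (sgnB w)%:~R ^+ e * shuffle_prob a w
  = (a%:R ^+ n)^-1 * \sum_(j : a.-tuple 'I_n.+1 | (\sum_(i < a) tnth j i == n)%N)
      wsum a n (fun f => (fits a f (cut_and_turn j (deck 1%g)))%:R *
        deck_sgn e n (run f (cut_and_turn j (deck 1%g)) [::])).
Proof.
under eq_bigr => w _ do rewrite mulr_sumr.
rewrite exchange_big mulr_sumr; apply: eq_bigr => j /eqP sj /=.
set ps := cut_and_turn _ _; have sps : size ps = a by rewrite size_cut.
have sd : size (deck (1 : {perm pm n})%g) = n by rewrite size_deck.
have shps : sumn (shape ps) = n.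
  by rewrite sumn_shape sps -[RHS]sj; apply: eq_bigr => i _; rewrite size_nth_cut.
rewrite (eq_wsum _ _ _ (fun f => \sum_(w in B n) (sgnB w)%:~R ^+ e *
    ((fits a f ps)%:R * (run f ps [::] == deck w)%:R))); last first.
  move=> f _ _; rewrite mulr_sumr; apply: eq_bigr => w _.
  by rewrite mulrCA [_ == _]eq_sym.
rewrite wsum_sum mulr_sumr; apply: eq_bigr => w _.
(* The multinomial coefficient of the cut is exactly the normalization giving every fitting word
   weight 1; only the factor [(a%:R ^+ n)^-1] remains. *)
rewrite wsumZ; have := drop_prob_words n ps [::] (deck w) shps.
rewrite sps => <-; rewrite [RHS]mulrCA; congr (_ * _).
rewrite [RHS]mulrA [(_ ^+ n)^-1 * _]mulrC; congr (_ / _ * _).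
by congr (_ / _%:R); apply: eq_bigr => i _; rewrite size_nth_cut.
Qed.

Lemma expr_natr_neq0 a n : (1 <= a)%N -> a%:R ^+ n != 0 :> rat.
Proof. by move=> a1; rewrite expf_neq0 // pnatr_eq0 -lt0n. Qed.

(** With exponent 0, each of the [a ^ n] words fits one cut and contributes 1. *)
Lemma total_shuffle_prob n a : (1 <= a)%N ->
  \sum_(w in B n) shuffle_prob a w = 1.
Proof.
move=> a1; have := sum_shuffle_prob 0 n a.
under eq_bigr => w _ do rewrite expr0 mul1r.
move=> ->; rewrite -wsum_sum (eq_wsum _ _ _ (fun=> 1)).
  by rewrite wsum1 mulVf ?expr_natr_neq0.
move=> f sf allf; have sd : size (deck (1 : {perm pm n})%g) = n by rewrite size_deck.
have := sum_fits_cut n a _ f (fun=> 1) sd sf allf; rewrite [RHS]big1 // => sum1.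
rewrite -[RHS]sum1; apply: eq_bigr => j /eqP sj; rewrite big1_eq.
have [fitsf|_] := boolP (fits _ _ _); last by rewrite !mul0r.
rewrite deck_sgn_run0 ?size_cut // cats0 deck_sgn_cut // deck_sgn_deck ?group1 //.
by rewrite expr0 big1 ?mulr1 // => i _; rewrite mul0n.
Qed.

Lemma sum_signs a : \sum_(i < a) (-1) ^+ i = (odd a)%:R :> rat.
Proof.
elim: a => [|a IH]; first by rewrite big_ord0.
by rewrite big_ord_recr IH -signr_odd /=; case: (odd a).
Qed.

(** Only the factor at [k = i] can differ from 1, and it occurs exactly when [i] is odd. *)
Lemma prod_sign_eq a (i : 'I_a) : \prod_(k < a | odd k) (-1) ^+ (i == k) = (-1) ^+ i :> rat.
Proof.
rewrite big_mkcond (bigD1 i) //= eqxx big1 ?mulr1 => [|k ki].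
  by rewrite -[RHS]signr_odd; case: (odd i).
by rewrite eq_sym (negPf ki); case: ifP.
Qed.

(** Removing a first pair of letters [i] lowers one count by 2 and its [uphalf] by 1, giving a
    factor [(-1) ^+ i]. A single last letter gives the same factor, as [uphalf 1 = 1]. The
    alternating sum over [i < a] is 1 for odd [a]. *)
Lemma wsum_doubled a n : odd a ->
  wsum a n (fun f => (doubled f)%:R *
    \prod_(k < a | odd k) (-1) ^+ uphalf (count_mem (val k) f)) = 1.
Proof.
move=> odda; have sum1 : 1 = \sum_(i < a) (-1) ^+ i :> rat by rewrite sum_signs odda.
have [k] := ubnP n; elim: k n => // k IH [|[|n]] ltn.
- by rewrite /= big1 ?mulr1.
- rewrite /= [RHS]sum1.
  apply: eq_bigr => i _; rewrite mul1r -prod_sign_eq; apply: eq_bigr => l _.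
  by rewrite addn0 -val_eqE; case: (_ == _).
rewrite /= [RHS]sum1.
apply: eq_bigr => i _; rewrite (bigD1 i) //= [X in _ + X]big1 ?addr0.
  rewrite -[RHS]mulr1 -[X in _ = _ * X](IH n (ltnW ltn)) -wsumZ; apply: eq_wsum => f _ _.
  rewrite eqxx /= mulrCA; congr (_ * _); rewrite -prod_sign_eq -big_split /=.
  apply: eq_bigr => l _; rewrite -exprD -val_eqE; case: (_ == _) => //=; rewrite !add1n.
move=> l; rewrite eq_sym -val_eqE /= => /negPf il.
by apply: wsum0 => f; rewrite il mul0r.
Qed.

Lemma mean_sgnB_shuffle n a : odd a ->
  \sum_(w in B n) (sgnB w)%:~R * shuffle_prob a w = (a%:R ^+ n)^-1.
Proof.
move=> odda; have := sum_shuffle_prob 1 n a.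
under eq_bigr => w _ do rewrite expr1.
move=> ->; rewrite -[RHS]mulr1 -[X in _ = _ * X](wsum_doubled a n odda); congr (_ * _).
have sd : size (deck (1 : {perm pm n})%g) = n by rewrite size_deck.
(* The product over letter counts is rewritten as a sum over cuts, where only the cut matching the
   word contributes. *)
rewrite (eq_wsum _ _ _ (fun f => (doubled f)%:R * \sum_(j : a.-tuple 'I_n.+1 |
    (\sum_(i < a) tnth j i == n)%N) (fits a f (cut_and_turn j (deck 1%g)))%:R *
      \prod_(i < a | odd i) (-1) ^+ uphalf (tnth j i))); last first.
  move=> f sf allf; congr (_ * _).
  by rewrite (sum_fits_cut n a _ f (fun m => (-1) ^+ uphalf m)).
rewrite [RHS](eq_wsum _ _ _ (fun f => \sum_(j : a.-tuple 'I_n.+1 |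
    (\sum_(i < a) tnth j i == n)%N) (doubled f)%:R *
     ((fits a f (cut_and_turn j (deck 1%g)))%:R *
      \prod_(i < a | odd i) (-1) ^+ uphalf (tnth j i)))); last first.
  by move=> f _ _; rewrite mulr_sumr.
rewrite wsum_sum; apply: eq_bigr => j /eqP sj.
have := wsum_run n n (cut_and_turn j (deck 1%g)) [::]; rewrite size_cut => ->.
rewrite cats0 deck_sgn_cut // deck_sgn_deck ?group1 // sgnB1 expr1 mulr1.
by apply: eq_wsum => f _ _; under eq_bigr => i _ do rewrite mul1n.
Qed.

(** * Iterated shuffles and the probability of sign 1 *)

Lemma total_iter_shuffle_prob n a r : (1 <= a)%N ->
  \sum_(w in B n) iter_shuffle_prob a r w = 1.
Proof.
move=> a1; elim: r => [|r IH] /=.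
  rewrite (bigD1 1%g) ?group1 //= eqxx big1 ?addr0 // => w /andP[_ /negPf->] //.
rewrite exchange_big -[RHS]IH; apply: eq_bigr => v vB.
rewrite -mulr_sumr (reindex_inj (mulIg v)) /=.
under eq_bigl => w do rewrite groupMr //.
under eq_bigr => w _ do rewrite mulgK.
by rewrite total_shuffle_prob ?mulr1.
Qed.

(** The sign is a character of [B n], so its mean under a convolution is the product of the
    means. *)
Lemma mean_sgnB_iter_shuffle n a r : odd a ->
  \sum_(w in B n) (sgnB w)%:~R * iter_shuffle_prob a r w = (a%:R ^+ (r * n))^-1.
Proof.
move=> odda; elim: r => [|r IH] /=.
  rewrite (bigD1 1%g) ?group1 //= eqxx sgnB1 mul1r big1 ?addr0 ?invr1 //.
  by move=> w /andP[_ /negPf->]; rewrite mulr0.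
under eq_bigr => w _ do rewrite mulr_sumr.
rewrite exchange_big mulSn addnC exprD invfM -IH mulr_suml; apply: eq_bigr => v vB.
rewrite -(mean_sgnB_shuffle n a odda) mulr_sumr (reindex_inj (mulIg v)) /=.
apply: eq_big => [w|w]; first by rewrite groupMr.
rewrite groupMr // => wB; rewrite mulgK sgnB_mul // intrM.
by rewrite (mulrC (sgnB w)%:~R) mulrACA.
Qed.

Theorem theorem5p8 (n a r : nat) (hn : (1 <= n)%N) (ha : (1 <= a)%N)
    (ha_odd : odd a) :
  \sum_(w in B n | sgnB w == 1) iter_shuffle_prob a r w
    = 1 / 2 + 1 / (2 * a%:R ^+ (r * n)).
Proof.
(* On [B n] the indicator of sign 1 is [(1 + sgnB w) / 2], which reduces the claim to the total mass
   and the mean sign. *)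
transitivity (\sum_(w in B n) (1 + (sgnB w)%:~R) / 2 * iter_shuffle_prob a r w).
  rewrite big_mkcondr; apply: eq_bigr => w wB.
  by case: (sgnB_pm1 n w wB) => -> /=; rewrite ?mul1r // subrr !mul0r.
under eq_bigr => w _ do rewrite mulrAC mulrDl mul1r.
rewrite -mulr_suml big_split /= total_iter_shuffle_prob // mean_sgnB_iter_shuffle //.
by rewrite mulrDl invfM !mul1r (mulrC 2^-1).
Qed.
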